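(* Let $p\ge 1$ and let $u_0\in C^0(\mathbb{R}^n)$ be such that $$u_0(x)\ge c_0\,\exp\Big\{-\alpha\exp\big(\beta|x|^\gamma\big)\Big\}\qquad\text{for all }x\in\mathbb{R}^n$$ with positive constants $c_0,\alpha,\beta$ and $\gamma$. Then there exist $t_0>e$ and $C>0$ with the property that any positive classical solution $u$ of $$u_t=u^p\Delta u\ \ (x\in\mathbb{R}^n,\ t>0),\qquad u(x,0)=u_0(x)\ \ (x\in\mathbb{R}^n)$$ satisfies $$\|u(\cdot,t)\|_{L^\infty(\mathbb{R}^n)}\ge C\,t^{-\frac1p}\,(\ln\ln t)^{\frac{2}{p\gamma}}\qquad\text{for all }t\ge t_0.$$
   Context: A positive classical solution is a positive function $u\in C^0(\mathbb{R}^n\times[0,\infty))\cap C^{2,1}(\mathbb{R}^n\times(0,\infty))$ satisfying the equation and the initial condition pointwise. *)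

(* Defs.v *)
From HB Require Import structures.
From mathcomp Require Import all_boot all_order all_algebra.
From mathcomp Require Import all_classical all_reals all_analysis.

Set Implicit Arguments.
Unset Strict Implicit.
Unset Printing Implicit Defensive.

Import Order.TTheory GRing.Theory Num.Theory.
Import numFieldNormedType.Exports.

Local Open Scope classical_set_scope.
Local Open Scope ring_scope.

(* The library norm on ['rV[R]_n] is the maximum norm. *)
Definition enorm (R : realType) (n : nat) (x : 'rV[R]_n) : R :=
  Num.sqrt (\sum_(i < n) x 0 i ^+ 2).

Section lebesgue_cons.
Local Open Scope ereal_scope.
Context (R : realType) (n : nat).
Variable mu : {sigma_finite_measure
  set (n.-tuple (measurableTypeR R)) -> \bar R}.

Definition tcons (z : measurableTypeR R * n.-tuple (measurableTypeR R)) :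
  n.+1.-tuple (measurableTypeR R) := [the n.+1.-tuple _ of z.1 :: z.2].

Lemma measurable_tcons : measurable_fun setT tcons.
Proof. exact: measurable_cons. Qed.

Definition lebesgue_cons : set (n.+1.-tuple (measurableTypeR R)) -> \bar R :=
  pushforward (@lebesgue_measure R \x mu) tcons.

Let lebesgue_cons0 : lebesgue_cons set0 = 0.
Proof. by rewrite /lebesgue_cons /pushforward preimage_set0 measure0. Qed.

Let lebesgue_cons_ge0 A : 0 <= lebesgue_cons A.
Proof. by rewrite /lebesgue_cons /pushforward measure_ge0. Qed.

Let lebesgue_cons_sigma_additive : semi_sigma_additive lebesgue_cons.
Proof.
move=> F mF tF mUF; rewrite /lebesgue_cons /pushforward preimage_bigcup.
apply: measure_semi_sigma_additive.
- by move=> k; rewrite -[X in measurable X]setTI; exact: measurable_tcons.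
- apply/trivIsetP => i j _ _ ij; rewrite -preimage_setI.
  by move/trivIsetP : tF => /(_ _ _ _ _ ij) ->//; rewrite preimage_set0.
- by rewrite -preimage_bigcup -[X in measurable X]setTI;
    exact: measurable_tcons.
Qed.

HB.instance Definition _ := isMeasure.Build _ _ _ lebesgue_cons
  lebesgue_cons0 lebesgue_cons_ge0 lebesgue_cons_sigma_additive.

Let lebesgue_cons_sigma_finite : sigma_finite setT lebesgue_cons.
Proof.
have /sigma_finiteP[F [FT ndF Ffin]] := sigma_finiteT (@lebesgue_measure R).
have /sigma_finiteP[G [GT ndG Gfin]] := sigma_finiteT mu.
have FGT : \bigcup_k (F k `*` G k) = setT.
  rewrite -setXTT FT GT predeqE => -[x y]; split.
    by move=> [k _ [Fk Gk]]; split; exists k.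
  move=> [/= [i _ Fi] [j _ Gj]]; exists (maxn i j) => //; split => /=.
    by move: x Fi; exact/subsetPset/ndF/leq_maxl.
  by move: y Gj; exact/subsetPset/ndG/leq_maxr.
pose uncons (s : n.+1.-tuple (measurableTypeR R)) :
  measurableTypeR R * n.-tuple (measurableTypeR R) :=
  (thead s, [tuple of behead s]).
have muncons : measurable_fun setT uncons.
  by apply: measurable_fun_pair; [exact: measurable_tnth|
    exact: measurable_behead].
have tconsK : cancel tcons uncons.
  by case=> a s; rewrite /uncons /tcons /= theadE; congr pair; exact/val_inj.
exists (fun k => uncons @^-1` (F k `*` G k)) => [|k].
  by rewrite -preimage_bigcup FGT preimage_setT.
have [mF Foo] := Ffin k; have [mG Goo] := Gfin k; split.
  rewrite -[X in measurable X]setTI; apply: muncons => //.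
  exact: measurableX.
rewrite /lebesgue_cons /pushforward -comp_preimage.
rewrite (_ : uncons \o tcons = id); last exact/funext.
rewrite preimage_id product_measure1E//.
by rewrite lte_mul_pinfty// ge0_fin_numE.
Qed.

HB.instance Definition _ := Measure_isSigmaFinite.Build _ _ _ lebesgue_cons
  lebesgue_cons_sigma_finite.

End lebesgue_cons.

(* Lebesgue measure on [R^n], the [n]-fold product of Lebesgue measure on [R];
   on the one-point space [R^0] it is the unit mass. *)
Fixpoint lebesgueN (R : realType) (n : nat) :
    {sigma_finite_measure set (n.-tuple (measurableTypeR R)) -> \bar R} :=
  match n with
  | 0 => \d_([tuple] : 0.-tuple (measurableTypeR R))
  | n'.+1 => lebesgue_cons (lebesgueN R n')
  end.

(* Topology lives on row vectors, the product sigma-algebra on tuples. *)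
Definition Linfty_norm (R : realType) (n : nat) (f : 'rV[R]_n -> R) : \bar R :=
  Lnorm (lebesgueN R n) +oo%E
    (fun s : n.-tuple (measurableTypeR R) => (f (\row_i tnth s i))%:E).

Section parabolic.
Context (R : realType) (n : nat).
Implicit Types (v : 'rV[R]_n -> R -> R).

Definition dt v : 'rV[R]_n -> R -> R := fun x t => 'D_1 (v x) t.

Definition dx (i : 'I_n) v : 'rV[R]_n -> R -> R :=
  fun x t => 'D_(delta_mx 0 i) (fun y => v y t) x.

Definition laplacian v : 'rV[R]_n -> R -> R :=
  fun x t => \sum_(i < n) dx i (dx i v) x t.

Definition continuous_pos_time v :=
  {in [set z : 'rV[R]_n * R | 0 < z.2], continuous (fun z => v z.1 z.2)}.

Definition continuous_nneg_time v :=
  {within [set z : 'rV[R]_n * R | 0 <= z.2],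
    continuous (fun z => v z.1 z.2)}.

Definition t_differentiable v := forall x t, 0 < t -> derivable (v x) t 1.

Definition x_differentiable v := forall i x t, 0 < t ->
  derivable (fun y => v y t) x (delta_mx 0 i : 'rV[R]_n).

Definition C21 v :=
  [/\ continuous_pos_time v,
      t_differentiable v /\ continuous_pos_time (dt v),
      x_differentiable v /\ (forall i, continuous_pos_time (dx i v)) &
      forall i, x_differentiable (dx i v) /\
        (forall j, continuous_pos_time (dx j (dx i v)))].

(* Values of [u] at negative times are irrelevant. *)
Definition positive_classical_solution (p : R) (u0 : 'rV[R]_n -> R)
    (u : 'rV[R]_n -> R -> R) :=
  [/\ continuous_nneg_time u /\ C21 u,
      forall x t, 0 <= t -> 0 < u x t,
      forall x t, 0 < t -> dt u x t = u x t `^ p * laplacian u x t &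
      forall x, u x 0 = u0 x].

End parabolic.

(* Main.v *)
Require Import Defs.
From HB Require Import structures.
From mathcomp Require Import all_boot all_order all_algebra.
From mathcomp Require Import all_classical all_reals all_analysis.
From mathcomp Require Import ess_sup_inf ring lra.

Import Order.TTheory GRing.Theory Num.Theory.
Import numFieldNormedType.Exports.

Local Open Scope classical_set_scope.
Local Open Scope ring_scope.

(** On the ball of radius [r], the function
    [(K / (T + t))^(1/p) * (1 - |x|^2 / r^2)] with [K = r^2 / (4 n p)] is a
    strict subsolution vanishing on the boundary. If it lies below [u0] at time
    [0], it stays below [u]: at a negative minimum of the difference over
    [ball x [0, t]] the time derivatives, the Laplacians and the values of the
    two functions are ordered so as to contradict the equation. Evaluating at
    the center with [T = t] and [r = (ln ln t / (2 beta))^(1/gamma)], for which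
    [u0] is at least [c0 * exp(-alpha * sqrt(ln t))] on the ball, gives a lower
    bound for [u 0 t], and hence for the essential supremum by continuity. *)

(** * Derivatives along lines and the second derivative test *)

Lemma difference_quotient_line (R : realType) (V : normedModType R)
    (f : V -> R) (x v : V) (s : R) :
  (fun h : R => h^-1 *: (((fun h : R => f (x + h *: v)) \o shift s)
    (h *: (1 : R)) - f (x + s *: v))) =
  (fun h => h^-1 *: ((f \o shift (x + s *: v)) (h *: v) - f (x + s *: v))).
Proof.
apply/funext => h /=.
by rewrite [h%:A]mulr1 scalerDl addrCA.
Qed.

Lemma derive_line (R : realType) (V : normedModType R) (f : V -> R)
    (x v : V) (s : R) :
  'D_1 (fun h : R => f (x + h *: v)) s = 'D_v f (x + s *: v).
Proof. by rewrite /derive difference_quotient_line. Qed.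

Lemma derivable_line (R : realType) (V : normedModType R) (f : V -> R)
    (x v : V) (s : R) :
  derivable f (x + s *: v) v -> derivable (fun h : R => f (x + h *: v)) s 1.
Proof. by rewrite /derivable difference_quotient_line. Qed.

(** Since ['D_1 f c = 0], a negative second derivative at [c] would make ['D_1 f] negative just to
    the right of [c], and the mean value theorem would then give values below [f c]. The second
    derivative is needed at [c] only. *)
Lemma derive2_local_min_ge0 (R : realType) (f : R -> R) (c : R) :
  (\forall s \near c, derivable f s 1) -> derivable ('D_1 f) c 1 ->
  (\forall s \near c, f c <= f s) -> 0 <= 'D_1 ('D_1 f) c.
Proof.
move=> df d2f cmin; rewrite leNgt; apply/negP => Dlt0.
have [e /= e0 ball_e] : exists2 e : R, 0 < e & forall s, `|c - s| < e ->
    derivable f s 1 /\ f c <= f s.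
  have /nbhs_ballP[e e0 He] : \forall s \near c, derivable f s 1 /\ f c <= f s.
    by near=> s; split; near: s.
  by exists e => // s cs; apply: He.
have cP : is_derive c 1 f 0.
  apply: (@derive1_at_min _ f (c - e) (c + e)).
  - by lra.
  - move=> s; rewrite in_itv/= => /andP[? ?].
    by apply: (ball_e _ _).1; rewrite ltr_norml; apply/andP; split; lra.
  - by rewrite in_itv/=; apply/andP; split; lra.
  - move=> s; rewrite in_itv/= => /andP[? ?].
    by apply: (ball_e _ _).2; rewrite ltr_norml; apply/andP; split; lra.
have Dc : 'D_1 f c = 0 by rewrite derive_val.
have [d /= d0 ball_d] : exists2 d : R, 0 < d & forall h, 0 < h < d ->
    'D_1 f (c + h) < 0.
  have := @cvgr_lt _ _ _ _ _ _ d2f _ Dlt0.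
  move=> [d /= d0 Hd]; exists d => // h /andP[h0 hd].
  have /= := Hd h; rewrite /ball/= sub0r normrN gtr0_norm// => /(_ hd).
  rewrite gt_eqF// => /(_ isT); rewrite Dc subr0 [h%:A]mulr1.
  by rewrite /GRing.scale/= pmulr_rlt0 ?invr_gt0// addrC.
pose h := Num.min e d / 2.
have m0 : 0 < Num.min e d by rewrite lt_min e0.
have h0 : 0 < h by rewrite /h divr_gt0.
have [he hd] : h < e /\ h < d.
  by split; rewrite /h; apply: (@lt_le_trans _ _ (Num.min e d));
    rewrite ?ge_min ?lexx ?orbT//; lra.
have dfs s : s \in `[c, c + h] -> derivable f s 1.
  rewrite in_itv/= => /andP[? ?].
  by apply: (ball_e _ _).1; rewrite ltr_norml; apply/andP; split; lra.
have [|||s] := @MVT R f ('D_1 f) c (c + h) _.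
- by lra.
- by move=> s sI; apply: DeriveDef => //; apply: dfs; exact: subset_itv_oo_cc.
- by apply: derivable_within_continuous => s; exact: dfs.
rewrite in_itv/= => /andP[cs sh] E.
have : f c <= f (c + h).
  by apply: (ball_e _ _).2; rewrite opprD addNKr normrN gtr0_norm.
rewrite -subr_ge0 E [c + h]addrC addrK pmulr_lge0// leNgt => /negP; apply.
have -> : s = c + (s - c) by lra.
by apply: ball_d; apply/andP; split; lra.
Unshelve. all: end_near. Qed.

(** * Cubes have positive measure; pointwise values and the essential supremum *)

Definition cube (R : realType) (n : nat) (x : 'rV[R]_n) (e : R) :
    set (n.-tuple (measurableTypeR R)) :=
  [set s | forall i, ball (x 0 i) e (tnth s i)].

Lemma measurable_cube (R : realType) (n : nat) (x : 'rV[R]_n) (e : R) :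
  measurable (cube R n x e).
Proof.
rewrite (_ : cube _ _ _ _ = \bigcap_(i in [set: 'I_n])
    (fun s : n.-tuple (measurableTypeR R) => tnth s i) @^-1` ball (x 0 i) e).
  apply: fin_bigcap_measurable => // i _.
  rewrite -[X in measurable X]setTI; apply: measurable_tnth => //.
  exact: (@measurable_realfun.measurable_ball).
by apply/seteqP; split => s /= sx i; [move=> _|]; apply: sx.
Qed.

(** Induction on the dimension: the preimage of a cube under [tcons] is an interval times a cube of
    one dimension less. In dimension 0 the cube is the single point, of mass 1. *)
Lemma lebesgueN_cube_gt0 (R : realType) (n : nat) (x : 'rV[R]_n) (e : R) :
  0 < e -> (0 < lebesgueN R n (cube R n x e))%E.
Proof.
move=> e0; elim: n x => [x|n IH x] /=.
  by rewrite diracE mem_set ?lte01// => -[].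
pose y : 'rV[R]_n := \row_i x 0 (lift ord0 i).
rewrite /lebesgue_cons /pushforward.
rewrite (_ : _ @^-1` _ = ball (x 0 ord0) e `*` cube R n y e).
  have mb : measurable (ball (x 0 ord0) e : set (measurableTypeR R)).
    exact: (@measurable_realfun.measurable_ball).
  rewrite (product_measure1E _ _ mb (measurable_cube _ _ _ _)).
  rewrite mule_gt0//.
  by rewrite [ltRHS](lebesgue_measure_ball _ (ltW e0)) lte_fin pmulrn_rgt0.
apply/seteqP; split => -[a s] /=.
  move=> sx; split=> [|i]; first by have := sx ord0; rewrite (tnth_nth 0).
  by have := sx (lift ord0 i); rewrite /y mxE !(tnth_nth 0).
move=> [ax sy] i; have [j ->|->] := unliftP ord0 i.
  by have := sy j; rewrite /y mxE !(tnth_nth 0).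
by rewrite (tnth_nth 0).
Qed.

(** If [|f x|] exceeded the norm, continuity would keep [|f|] above it on a whole cube around [x],
    which is not a null set. *)
Lemma Linfty_norm_ge (R : realType) (n : nat) (f : 'rV[R]_n -> R)
    (x : 'rV[R]_n) :
  {for x, continuous f} -> (`|f x|%:E <= Linfty_norm f)%E.
Proof.
move=> cf; set mu := lebesgueN R n.
pose g (s : n.-tuple (measurableTypeR R)) : \bar R :=
  (f (\row_i tnth s i))%:E.
rewrite /Linfty_norm unlock -/mu -/g.
(* [Lnorm] at [+oo] is the essential supremum only when the whole space has positive measure. *)
have muT : (0 < mu setT)%E.
  apply: lt_le_trans (lebesgueN_cube_gt0 R n x 1 ltr01) _.
  by apply: le_measure; rewrite ?inE//; exact: measurable_cube.
rewrite muT leNgt; apply/negP => ltfx.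
have [e /= e0 He] : exists2 e : R, 0 < e &
    forall s, cube R n x e s -> (ess_sup mu (abse \o g) < abse (g s))%E.
  (* The essential supremum is a real number: it is nonnegative, and it lies below [|f x|]. *)
  have [z z1 z2] : exists2 z : R, (ess_sup mu (abse \o g) <= z%:E)%E &
      z < `|f x|.
    have : (0 <= ess_sup mu (abse \o g))%E.
      by apply: ess_sup_gee => //; apply: nearW => s /=.
    by case: (ess_sup _ _) ltfx => // r + _; rewrite lte_fin => ?; exists r.
  have /nbhs_ballP[e /= e0 He] : \forall y \near x, z < `|f y|.
    exact: (cvgr_gt _ (cvg_norm cf) _ z2).
  exists e => // s sx; apply: le_lt_trans z1 _.
  rewrite lte_fin; apply: (He (\row_i tnth s i)).
  (* Balls of ['rV[R]_n] are taken in the maximum norm, so they correspond to cubes. *)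
  by split => // i j; rewrite (ord1 i) mxE.
have [N [mN N0 HN]] := ess_sup_ge mu (abse \o g).
have := lebesgueN_cube_gt0 R n x e e0; rewrite ltNge => /negP; apply.
rewrite -N0; apply: le_measure; rewrite ?inE//; first exact: measurable_cube.
by move=> s /He ltg; apply: HN => /=; apply/negP; rewrite -ltNge.
Qed.

(** * Comparison principle on a ball *)

Lemma derive_left_min_le0 (R : realType) (f : R -> R) (d c : R) :
  d < c -> derivable f c 1 -> (forall s, s \in `[d, c] -> f c <= f s) ->
  'D_1 f c <= 0.
Proof.
move=> dc df cmin; rewrite leNgt; apply/negP => Dgt0.
have := @cvgr_gt _ _ _ _ _ _ df _ Dgt0.
move=> [e /= e0 He].
pose h := Num.min e (c - d) / 2.
have m0 : 0 < Num.min e (c - d) by rewrite lt_min e0 subr_gt0.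
have h0 : 0 < h by rewrite /h divr_gt0.
have [he hd] : h < e /\ h < c - d.
  by split; rewrite /h; apply: (@lt_le_trans _ _ (Num.min e (c - d)));
    rewrite ?ge_min ?lexx ?orbT//; lra.
have /= := He (- h); rewrite sub0r opprK gtr0_norm// => /(_ he).
rewrite oppr_eq0 gt_eqF// => /(_ isT).
rewrite [(- h)%:A]mulr1 /GRing.scale/= invrN mulNr oppr_gt0.
rewrite pmulr_rlt0 ?invr_gt0// subr_lt0 ltNge (addrC _ c) cmin//.
by rewrite in_itv/=; apply/andP; split; lra.
Qed.

Definition sqnorm (R : realType) (n : nat) (x : 'rV[R]_n) : R :=
  \sum_(i < n) x 0 i ^+ 2.

Lemma continuous_sqnorm (R : realType) (n : nat) : continuous (sqnorm R n).
Proof.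
apply: (@continuous_big _ _ _ _ predT (@add_continuous R)) => i _ x.
exact: (continuousM (@coord_continuous R 1 n 0 i x)
  (@coord_continuous R 1 n 0 i x)).
Qed.

Lemma sqnorm_line (R : realType) (n : nat) (x : 'rV[R]_n) (i : 'I_n) (s : R) :
  sqnorm R n (x + s *: delta_mx 0 i) = sqnorm R n x + (2 * x 0 i) * s + s ^+ 2.
Proof.
rewrite /sqnorm (bigD1 i)//= [in RHS](bigD1 i)//= !mxE !eqxx/= mulr1.
under eq_bigr => j ji do rewrite !mxE (negbTE ji) andbF mulr0 addr0.
by ring.
Qed.

Lemma compact_sqnorm_le (R : realType) (n : nat) (r : R) :
  0 < r -> compact [set x : 'rV[R]_n | sqnorm R n x <= r ^+ 2].
Proof.
move=> r0.
apply: (@subclosed_compact _ _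
  [set v : 'rV[R]_n | forall i, v ord0 i \in `[(- r), r]]).
- apply: (closed_comp (f := sqnorm R n) (D := [set y | y <= r ^+ 2])).
    by move=> x _; exact: continuous_sqnorm.
  exact: closed_le.
- apply: (@rV_compact _ _ (fun=> `[(- r), r]%classic)) => i.
  exact: segment_compact.
- move=> x /= xr i; rewrite in_itv/= -ler_norml.
  rewrite -(@ler_pXn2r _ 2) ?nnegrE ?(ltW r0)// real_normK ?num_real//.
  apply: le_trans xr; rewrite /sqnorm (bigD1 i)//= lerDl.
  by apply: sumr_ge0 => j _; exact: sqr_ge0.
Qed.

(** The second derivative test applied to [f] plus the quadratic, whose second derivative is
    [2 * k]. The quadratic will be the variation of the subsolution along a coordinate line. *)
Lemma derive2_min_quadratic (R : realType) (f : R -> R) (b k : R) :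
  (\forall s \near (0:R), derivable f s 1) -> derivable ('D_1 f) 0 1 ->
  (\forall s \near (0:R), f 0 <= f s + (b * s + k * s ^+ 2)) ->
  - (2 * k) <= 'D_1 ('D_1 f) 0.
Proof.
move=> df d2f fmin.
pose q (s : R) := b * s + k * s ^+ 2.
have q0 : q 0 = 0 by rewrite /q expr0n !mulr0 addr0.
have dq (s : R) : is_derive s 1 q (b + 2 * k * s).
  rewrite /q; apply: is_derive_eq.
  by rewrite /GRing.scale/=; ring.
have d2q (s : R) : is_derive s 1 ('D_1 q) (2 * k).
  have -> : 'D_1 q = fun s : R => b + 2 * k * s.
    by apply/funext => x; rewrite derive_val.
  by apply: is_derive_eq; rewrite /GRing.scale/=; ring.
have ddq s : derivable q s 1 by have [] := dq s.
have dd2q : derivable ('D_1 q) 0 1 by have [] := d2q 0.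
have E : \forall s \near (0 : R), 'D_1 (f \+ q) s = ('D_1 f \+ 'D_1 q) s.
  by apply: filterS df => s ds; exact: (deriveD ds (ddq s)).
have : 0 <= 'D_1 ('D_1 (f \+ q)) 0.
  apply: derive2_local_min_ge0.
  - by apply: filterS df => s ds; exact: (derivableD ds (ddq s)).
  - suff E' : \forall s \near (0 : R),
        ('D_1 f \+ 'D_1 q) s = 'D_1 (f \+ q) s.
      exact: (near_eq_derivable E' (derivableD d2f dd2q)).
    by apply: filterS E => s ->.
  - by apply: filterS fmin => s /=; rewrite q0 addr0.
rewrite (@near_eq_derive _ _ _ _ ('D_1 f \+ 'D_1 q) _ _ E).
rewrite (deriveD d2f dd2q).
have [_ ->] := d2q 0.
by rewrite -lerBlDr sub0r.
Qed.

(** The bound on ['D_1 a] makes [w = a t * q x], with [q = 1 - |x|^2 / r^2], a strict subsolution: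
    its Laplacian is [- 2 n a / r^2], and [q^p <= q] for [0 < q <= 1]. Strictness yields a
    contradiction at a negative minimum of [u - w] without any perturbation. *)
Lemma comparison_ball (R : realType) (n : nat) (p : R) (u0 : 'rV[R]_n -> R)
    (u : 'rV[R]_n -> R -> R) (a : R -> R) (r : R) :
  1 <= p -> 0 < r -> positive_classical_solution p u0 u ->
  (forall t, 0 <= t -> 0 < a t) ->
  (forall t, 0 <= t -> {for t, continuous a}) ->
  (forall t, 0 < t -> derivable a t 1 /\
    'D_1 a t < - (2 * n%:R / r ^+ 2 * (a t `^ p * a t))) ->
  (forall x, sqnorm R n x <= r ^+ 2 ->
    a 0 * (1 - sqnorm R n x / r ^+ 2) <= u0 x) ->
  forall x t, sqnorm R n x <= r ^+ 2 -> 0 <= t ->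
    a t * (1 - sqnorm R n x / r ^+ 2) <= u x t.
Proof.
move=> p1 r0 [[cu [_ [tdu _] [xdu _] xxdu]] u_gt0 ueq uini] a0 ca da lei.
move=> x1 t1 x1r t10.
pose q (x : 'rV[R]_n) : R := 1 - sqnorm R n x / r ^+ 2.
rewrite -/(q x1).
have r2 : 0 < r ^+ 2 by rewrite exprn_gt0.
have cq : continuous q.
  have -> : q = cst 1 \- (sqnorm R n \* cst (r ^+ 2)^-1) by [].
  move=> x; apply: continuousB; first exact: cst_continuous.
  apply: continuousM; last exact: cst_continuous.
  exact: continuous_sqnorm.
pose D : set ('rV[R]_n * R) :=
  [set x | sqnorm R n x <= r ^+ 2] `*` `[0, t1].
have cD : compact D.
  by apply: compact_setX; [exact: compact_sqnorm_le|exact: segment_compact].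
pose f (z : 'rV[R]_n * R) : R := u z.1 z.2 - a z.2 * q z.1.
have cf : {within D, continuous f}.
  have cu' : {within D, continuous (fun z => u z.1 z.2)}.
    apply: continuous_subspaceW cu => z [_] /=.
    by rewrite in_itv/= => /andP[].
  have caq : {within D, continuous (fun z : 'rV[R]_n * R => a z.2 * q z.1)}.
    apply: continuous_in_subspaceT => z; rewrite inE => -[_] /=.
    rewrite in_itv/= => /andP[z20 _].
    apply: (@continuousM _ _ (a \o snd) (q \o fst)).
      by apply: continuous_comp; [exact: cvg_snd|exact: ca].
    by apply: continuous_comp; [exact: cvg_fst|exact: cq].
  by move=> z; apply: (@continuousB _ _ (subspace D)); [exact: cu'|exact: caq].
have D1 : D (x1, t1) by split => //=; rewrite in_itv/= t10 lexx.
have [[x t]] := compact_EVT_min (ex_intro _ _ D1) cD cf.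
rewrite inE => -[/= xr]; rewrite in_itv/= => /andP[t_ge0 tt1] fmin.
suff : 0 <= f (x, t).
  by move=> /le_trans/(_ (fmin _ (mem_set D1))); rewrite /f/= subr_ge0.
rewrite leNgt; apply/negP; rewrite /f/= subr_lt0 => ltuw.
(* Positivity of [u] gives [0 < u < a t * q x], so the minimum point is not on the lateral boundary.
   The initial ordering then excludes [t = 0]. *)
have q0 : 0 < q x.
  have := lt_trans (u_gt0 x t t_ge0) ltuw.
  by rewrite pmulr_rgt0// a0.
have q1 : q x <= 1.
  rewrite /q gerBl divr_ge0 ?(ltW r2)//.
  by apply: sumr_ge0 => j _; exact: sqr_ge0.
have xlt : sqnorm R n x < r ^+ 2.
  by move: q0; rewrite /q subr_gt0 ltr_pdivrMr// mul1r.
have t0 : 0 < t.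
  rewrite lt_neqAle t_ge0 andbT; apply/eqP => t0.
  by move: ltuw; rewrite -t0 uini ltNge lei.
have [dat Dat] := da t t0.
(* The minimum may sit at the final time [t1], so only earlier times are compared. *)
have Dt : dt u x t <= 'D_1 a t * q x.
  have dc : derivable (cst (q x) : R -> R) t 1 by exact: derivable_cst.
  have dw := derivableM dat dc.
  have := derive_left_min_le0 _ _ 0 t t0 (derivableB (tdu x t t0) dw).
  rewrite (deriveB (tdu x t t0) dw) (deriveM dat dc) derive_cst scaler0 add0r.
  rewrite /GRing.scale/= (mulrC (q x)) subr_le0; apply=> s.
  rewrite in_itv/= => /andP[s0 st].
  apply: (fmin (x, s)); rewrite inE; split => //=.
  by rewrite in_itv/= s0 (le_trans st).
have Lapl : - (2 * n%:R / r ^+ 2 * a t) <= laplacian u x t.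
  have Di i : - (2 * (a t / r ^+ 2)) <= dx i (dx i u) x t.
    pose e : 'rV[R]_n := delta_mx 0 i.
    have D1u : 'D_1 (fun s : R => u (x + s *: e) t) =
        fun s : R => dx i u (x + s *: e) t.
      by apply/funext => s; rewrite (derive_line _ _ (fun y => u y t)).
    have -> : dx i (dx i u) x t =
        'D_1 ('D_1 (fun s : R => u (x + s *: e) t)) 0.
      by rewrite D1u (derive_line _ _ (fun y => dx i u y t)) scale0r addr0.
    have [xxd _] := xxdu i.
    have d1 : \forall s \near (0 : R), 
        derivable (fun s : R => u (x + s *: e) t) s 1.
      exists 1; [exact: ltr01|move=> s _].
      by apply: (derivable_line _ _ (fun y => u y t)); exact: xdu.
    have d2 : derivable ('D_1 (fun s : R => u (x + s *: e) t)) 0 1.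
      rewrite D1u.
      by apply: (derivable_line _ _ (fun y => dx i u y t)); exact: xxd.
    have near_r : \forall s \near (0 : R), sqnorm R n (x + s *: e) < r ^+ 2.
      have cl :
          {for (0 : R), continuous (fun s : R => sqnorm R n (x + s *: e))}.
        apply: continuous_comp; last exact: continuous_sqnorm.
        apply: continuousD; first exact: cst_continuous.
        exact: scalel_continuous.
      by apply: (cvgr_lt _ cl); rewrite scale0r addr0.
    (* Along this line [- (a t * q)] is a constant plus [b * s + k * s ^+ 2], with this [b] and
       [k = a t / r ^+ 2]. *)
    apply: (derive2_min_quadratic _ _ (2 * x 0 i * (a t / r ^+ 2)) _ d1 d2).
    apply: filterS near_r => s sr.
    have Ds : D (x + s *: e, t).
      by split; rewrite /= ?(ltW sr)// in_itv/= t_ge0.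
    have := fmin _ (mem_set Ds).
    rewrite /f/= /q sqnorm_line scale0r addr0.
    by lra.
  rewrite /laplacian.
  apply: (@le_trans _ _ (\sum_(i < n) - (2 * (a t / r ^+ 2)))).
    by rewrite sumr_const card_ord -mulr_natl; lra.
  by apply: ler_sum => i _; exact: Di.
(* Here [1 <= p] enters: [u < a q] and [0 < q <= 1] give [u^p <= a^p q^p <= a^p q]. The chain [u_t
   <= a' q < - (2n / r^2) a^(p+1) q <= u^p * (- 2n a / r^2) <= u^p * laplacian u] then contradicts
   the equation. *)
have at0 := a0 t t_ge0.
have up : u x t `^ p <= a t `^ p * q x.
  apply: (@le_trans _ _ ((a t * q x) `^ p)).
    apply: ge0_ler_powR; rewrite ?nnegrE.
    - by lra.
    - exact: ltW (u_gt0 _ _ t_ge0).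
    - by rewrite mulr_ge0// ltW.
    - exact: ltW.
  rewrite powRM; [|exact: ltW|exact: ltW].
  rewrite ler_pM2l ?powR_gt0//.
  by apply: ge1r_powR => //; rewrite q0.
have k0 : 0 <= 2 * n%:R / r ^+ 2 * a t.
  by rewrite !mulr_ge0 ?ler0n ?invr_ge0 ?(ltW r2) ?(ltW at0).
move: Dt; rewrite ueq// leNgt => /negP; apply.
apply: (@lt_le_trans _ _ (- (2 * n%:R / r ^+ 2 * (a t `^ p * a t)) * q x)).
  by rewrite ltr_pM2r.
apply: (@le_trans _ _ (u x t `^ p * - (2 * n%:R / r ^+ 2 * a t))); last first.
  by rewrite ler_wpM2l// powR_ge0.
rewrite mulrN mulNr lerN2.
apply: le_trans (ler_wpM2r k0 up) _.
by rewrite le_eqVlt; apply/orP; left; apply/eqP; ring.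
Qed.

(** * The explicit subsolution and its large-time asymptotics *)

Section decay_profile.
Context (R : realType) (p K T : R).
Hypotheses (p0 : 0 < p) (K0 : 0 < K) (T0 : 0 < T).

(** The solution of the ordinary differential equation [a' = - a^(p+1) / (p K)] with
    [a(0) = (K / T)^(1/p)]. *)
Definition decay_profile (s : R) : R := (K / (T + s)) `^ p^-1.

Lemma decay_profile_base_gt0 (s : R) : 0 <= s -> 0 < K / (T + s).
Proof. by move=> s0; rewrite divr_gt0// ltr_wpDr. Qed.

Lemma powR_decay_profile (s : R) : 0 <= s -> decay_profile s `^ p = K / (T + s).
Proof.
move=> s0; rewrite /decay_profile -powRrM mulVf ?gt_eqF// powRr1//.
exact/ltW/decay_profile_base_gt0.
Qed.

Lemma is_derive_decay_profile (s : R) : 0 <= s ->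
  is_derive s 1 decay_profile (- (p^-1 / (T + s) * decay_profile s)).
Proof.
move=> s0; have Ts0 : 0 < T + s by rewrite ltr_wpDr.
have base0 := decay_profile_base_gt0 s s0.
have d1 : is_derive s (1 : R) (fun s : R => K / (T + s)) (- (K / (T + s) ^+ 2)).
  have Tsn : T + s != 0 by rewrite gt_eqF.
  have d0 : is_derive s (1 : R) (fun s : R => T + s) 1.
    apply: (is_derive_eq (is_deriveD (is_derive_cst T s 1) (is_derive_id s 1))).
    by rewrite add0r.
  have dV := @is_deriveV R (fun s : R => T + s) s 1 1 Tsn d0.
  have dZ := is_deriveZ K dV.
  by apply: (is_derive_eq dZ); rewrite /GRing.scale/= mulr1 mulrN.
have := @is_derive1_comp _ (fun x => x `^ p^-1) (fun s : R => K / (T + s)) s _ _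
  (is_derive1_powR p^-1 base0) d1.
move=> h; apply: (is_derive_eq h).
rewrite powRB ?(gt_eqF base0) ?implybT// powRr1 ?(ltW base0)//.
rewrite /decay_profile.
by field; rewrite !gt_eqF.
Qed.

End decay_profile.

Lemma solution_at_center_ge (R : realType) (n : nat) (p : R)
    (u0 : 'rV[R]_n -> R) (u : 'rV[R]_n -> R -> R) (r T : R) :
  (0 < n)%N -> 1 <= p -> 0 < r -> 0 < T ->
  positive_classical_solution p u0 u ->
  (forall x, sqnorm R n x <= r ^+ 2 ->
    (r ^+ 2 / (4 * n%:R * p) / T) `^ p^-1 <= u0 x) ->
  forall t, 0 <= t -> (r ^+ 2 / (4 * n%:R * p) / (T + t)) `^ p^-1 <= u 0 t.
Proof.
move=> n0 p1 r0 T0 solu ini t t0.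
have p0 : 0 < p by lra.
have nR : 0 < n%:R :> R by rewrite ltr0n.
set K := _ / (4 * _ * _) in ini *.
have K0 : 0 < K by rewrite divr_gt0 ?exprn_gt0// !mulr_gt0.
have sq0 : sqnorm R n 0 = 0.
  by rewrite /sqnorm big1// => i _; rewrite mxE expr0n.
have prof_gt0 s : 0 <= s -> 0 < decay_profile R p K T s.
  by move=> s0; rewrite powR_gt0// decay_profile_base_gt0.
suff : decay_profile R p K T t * (1 - sqnorm R n 0 / r ^+ 2) <= u 0 t.
  by rewrite sq0 mul0r subr0 mulr1.
apply: (comparison_ball R n p u0 u _ r p1 r0 solu) => //.
- move=> s s0; apply: differentiable_continuous; apply/derivable1_diffP.
  by have [] := is_derive_decay_profile R p K T p0 K0 T0 s s0.
- move=> s s0.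
  have [ds Ds] := is_derive_decay_profile R p K T p0 K0 T0 s (ltW s0).
  split=> //; rewrite Ds powR_decay_profile ?ltW// ltrN2 mulrA.
  rewrite ltr_pM2r ?prof_gt0 ?ltW//.
  have Ts0 : 0 < T + s by lra.
  (* With [K = r^2 / (4 n p)] the profile decays at twice the critical rate, hence the strict
     inequality. *)
  rewrite (_ : _ * _ = 2^-1 * (p^-1 / (T + s))).
    by rewrite gtr_pMl ?divr_gt0 ?invr_gt0//; lra.
  by rewrite /K; field; rewrite !gt_eqF.
- move=> x xr; apply: le_trans (ini x xr).
  have := prof_gt0 0 (lexx 0); rewrite /decay_profile addr0 => w0.
  rewrite ger_pMr//.
  rewrite gerBl divr_ge0 ?exprn_ge0 ?(ltW r0)//.
  by apply: sumr_ge0 => i _; exact: sqr_ge0.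
- by rewrite sq0 exprn_ge0// ltW.
Qed.

(** Here [y] stands for [sqrt (ln t)] and [(ln y / beta)^(1/gamma)] for the radius, at which the
    inner exponential of the lower bound on [u0] equals [y]. The factor [exp (- y^2 / p)] from
    [t^(-1/p)] beats [exp (- alpha y)]. *)
Lemma amplitude_le_double_exp (R : realType) (p c c0 alpha beta gamma : R) :
  0 < p -> 0 < c -> 0 < c0 -> 0 < alpha -> 0 < beta -> 0 < gamma ->
  exists2 Y : R, 2 <= Y & forall y, Y <= y ->
    (((ln y / beta) `^ gamma^-1) ^+ 2 / c / expR (y ^+ 2)) `^ p^-1 <=
    c0 * expR (- (alpha * y)).
Proof.
move=> p0 c_gt0 c00 a0 b0 g0.
pose A := - (2 / gamma * ln beta) - ln c - p * ln c0.
have g2 : 0 < 2 / gamma by rewrite divr_gt0.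
have pa : 0 < p * alpha by rewrite mulr_gt0.
(* After taking logarithms, what is needed is [2 / gamma * ln (ln y) + A + p * alpha * y <= y ^+ 2].
   Each term on the left is at most its coefficient, or [|A|], times [y]; the summand 2 keeps [ln y]
   positive. *)
exists (2 + 2 / gamma + p * alpha + `|A|) => [|y Yy].
  by have := normr_ge0 A; lra.
have A0 := normr_ge0 A; have AA := ler_norm A.
have y2 : 2 <= y by lra.
have y0 : 0 < y by lra.
have ly0 : 0 < ln y by rewrite ln_gt0//; lra.
have lyb : 0 < ln y / beta by rewrite divr_gt0.
have r0 : 0 < (ln y / beta) `^ gamma^-1 by rewrite powR_gt0.
have r20 : 0 < ((ln y / beta) `^ gamma^-1) ^+ 2 / c.
  by rewrite divr_gt0// exprn_gt0.
rewrite {1}/powR gt_eqF; last by rewrite divr_gt0// expR_gt0.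
rewrite (_ : c0 * _ = expR (ln c0 - alpha * y)); last first.
  by rewrite expRD lnK.
rewrite ler_expR.
rewrite ln_div ?posrE ?expR_gt0// expRK ln_div ?posrE ?exprn_gt0//.
rewrite lnXn// ln_powR ln_div ?posrE//.
rewrite mulrC ler_pdivrMr//.
rewrite (_ : _ *+ 2 = 2 / gamma * ln (ln y) - 2 / gamma * ln beta); last first.
  by ring.
have l1 : ln (ln y) <= y.
  by apply: le_trans (ltW (ln_sublinear y0)); exact: ltW (ln_sublinear ly0).
have : 2 / gamma * ln (ln y) <= 2 / gamma * y by rewrite ler_pM2l.
have : (2 + 2 / gamma + p * alpha + `|A|) * y <= y * y by rewrite ler_pM2r.
have : `|A| * 1 <= `|A| * y by rewrite ler_wpM2l//; lra.
rewrite expr2.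
move: AA; rewrite {1}/A; move: (`|A|) => B.
by lra.
Qed.

Theorem corollary1p8 (R : realType) (n : nat) (hn : (0 < n)%N)
    (p : R) (hp : 1 <= p) (u0 : 'rV[R]_n -> R) (hu0 : continuous u0)
    (c0 alpha beta gamma : R)
    (hc0 : 0 < c0) (halpha : 0 < alpha) (hbeta : 0 < beta) (hgamma : 0 < gamma)
    (hlow : forall x : 'rV[R]_n,
      c0 * expR (- (alpha * expR (beta * enorm x `^ gamma))) <= u0 x) :
  exists t0 C : R, [/\ expR 1 < t0, 0 < C &
    forall u : 'rV[R]_n -> R -> R, positive_classical_solution p u0 u ->
    forall t : R, t0 <= t ->
      ((C * t `^ (- p^-1) * ln (ln t) `^ (2 / (p * gamma)))%:E
         <= Linfty_norm (fun x => u x t))%E].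
Proof.
have p0 : 0 < p by lra.
have nR : 0 < n%:R :> R by rewrite ltr0n.
pose c : R := 4 * n%:R * p.
have c_gt0 : 0 < c by rewrite !mulr_gt0.
have [Y Y2 HY] := amplitude_le_double_exp R p c c0 alpha beta gamma
  p0 c_gt0 hc0 halpha hbeta hgamma.
have c2 : 0 < (2 * c)^-1 by rewrite invr_gt0 mulr_gt0.
have b2 : 0 < (2 * beta)^-1 by rewrite invr_gt0 mulr_gt0.
(* For [t] beyond this time, [sqrt (ln t)] is at least [Y]. In the constant, [2 * c] comes from
   [T + t = 2 t], and [2 * beta] from [ln y = ln (ln t) / 2]. *)
exists (expR (Y ^+ 2)).
exists ((2 * c)^-1 `^ p^-1 * (2 * beta)^-1 `^ (2 / (p * gamma))).
split.
- by rewrite ltr_expR expr2; nra.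
- by rewrite mulr_gt0// powR_gt0.
move=> u solu t tY.
have t0 : 0 < t by apply: lt_le_trans tY; exact: expR_gt0.
have lt : Y ^+ 2 <= ln t.
  by rewrite -[leLHS]expRK ler_ln// posrE expR_gt0.
pose y := Num.sqrt (ln t).
have yE : y ^+ 2 = ln t by rewrite sqr_sqrtr// (le_trans _ lt)// sqr_ge0.
have Yy : Y <= y by rewrite -(@ler_pXn2r _ 2) ?nnegrE ?sqrtr_ge0 ?yE//; lra.
have y0 : 0 < y by lra.
have ly0 : 0 < ln y by rewrite ln_gt0//; lra.
have L2 : ln (ln t) = 2 * ln y by rewrite -yE lnXn// mulr_natl.
pose r := (ln y / beta) `^ gamma^-1.
have rb : 0 < ln y / beta by rewrite divr_gt0.
have r0 : 0 < r by rewrite powR_gt0.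
have ini x : sqnorm R n x <= r ^+ 2 -> (r ^+ 2 / c / t) `^ p^-1 <= u0 x.
  move=> xr; have := HY y Yy; rewrite -/r yE lnK// => /le_trans; apply.
  apply: le_trans (hlow x).
  rewrite ler_pM2l// ler_expR lerN2 ler_pM2l//.
  (* It remains to see that [beta |x|^gamma <= ln y] on the ball, which is how [r] was chosen. *)
  rewrite -[leRHS](@lnK _ y)// ler_expR mulrC -ler_pdivlMr//.
  have -> : ln y / beta = r `^ gamma.
    by rewrite /r -powRrM mulVf ?gt_eqF// powRr1// ltW.
  apply: ge0_ler_powR; rewrite ?nnegrE ?sqrtr_ge0 ?(ltW r0) ?(ltW hgamma)//.
  by rewrite -(ger0_norm (ltW r0)) -sqrtr_sqr ler_wsqrtr.
have cu : {for 0, continuous (fun x : 'rV[R]_n => u x t)}.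
  have [[_ [cpos _ _ _]] _ _ _] := solu.
  have ct : {for 0, continuous (fun x : 'rV[R]_n => (x, t : R))}.
    exact: (@cvg_pair _ _ _ (nbhs (0 : 'rV[R]_n)) (nbhs (0 : 'rV[R]_n))
      (nbhs (t : R)) _ _ _ id (cst t) cvg_id (cvg_cst t)).
  apply: (@continuous_comp _ _ _ (fun x : 'rV[R]_n => (x, t : R))
    (fun z => u z.1 z.2)); first exact: ct.
  by apply: cpos; rewrite inE.
apply: le_trans (Linfty_norm_ge R n _ 0 cu).
rewrite lee_fin; apply: le_trans (ler_norm _).
(* The shift [T] is the time [t] itself, so the base of the profile only halves between times 0 and
   [t]. *)
have := solution_at_center_ge R n p u0 u r t hn hp r0 t0 solu ini t (ltW t0).
apply: le_trans; rewrite -/c.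
have -> : r ^+ 2 / c / (t + t) = (2 * c)^-1 * t^-1 * r ^+ 2.
  by field; rewrite !gt_eqF// addr_gt0.
have -> : r ^+ 2 = ((2 * beta)^-1 * ln (ln t)) `^ (2 / gamma).
  rewrite -powR_mulrn ?(ltW r0)// /r -powRrM L2; congr (_ `^ _).
    by field; rewrite gt_eqF.
  by rewrite mulrC.
have lt0 : 0 < ln (ln t) by rewrite L2 mulr_gt0.
have ti : 0 < t^-1 by rewrite invr_gt0.
rewrite (powRM _ (mulr_ge0 (ltW c2) (ltW ti)) (powR_ge0 _ _)).
rewrite (powRM _ (ltW c2) (ltW ti)).
rewrite -powRrM.
have -> : 2 / gamma * p^-1 = 2 / (p * gamma) by field; rewrite !gt_eqF.
rewrite powRM ?(ltW b2) ?(ltW lt0)//.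
have -> : t^-1 `^ p^-1 = t `^ (- p^-1).
  by rewrite -powR_inv1 ?(ltW t0)// -powRrM mulN1r.
by rewrite le_eqVlt; apply/orP; left; apply/eqP; ring.
Qed.
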